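(* The Fano polygon $P=\mathrm{conv}\{(-9,-190),(19,27),(15,113),(-13,112)\}\subset N_{\mathbb{Q}}$ is a Kähler–Einstein Fano quadrilateral. In particular, it is not true that every Kähler–Einstein Fano polygon is either symmetric or a triangle.
   Context: Let $N=\mathbb{Z}^2$, $M=\mathrm{Hom}(N,\mathbb{Z})$, $N_{\mathbb{Q}}=N\otimes\mathbb{Q}$, $M_{\mathbb{Q}}=M\otimes\mathbb{Q}$. A convex lattice polygon in $N_{\mathbb{Q}}$ is Fano if the origin lies in its strict interior and every vertex $(x,y)$ satisfies $\gcd(x,y)=1$. The dual of $P$ is $P^*=\{u\in M_{\mathbb{Q}} : u(x)\ge -1\ \forall x\in P\}$. A Fano polygon is Kähler–Einstein if the barycentre (centroid) of $P^*$ is the origin. With $\mathrm{Aut}(P)=\{G\in \mathrm{GL}_2(\mathbb{Z}) : GP=P\}$, the polygon $P$ is symmetric if the only point of $N_{\mathbb{Q}}$ fixed by all of $\mathrm{Aut}(P)$ is $0$. *)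

(* Defs.v *)
From HB Require Import structures.
From mathcomp Require Import all_boot all_order all_algebra.
From mathcomp Require Import all_classical all_reals all_analysis.

Set Implicit Arguments.
Unset Strict Implicit.
Unset Printing Implicit Defensive.

Import Order.TTheory GRing.Theory Num.Theory.
Import numFieldNormedType.Exports.

Local Open Scope classical_set_scope.
Local Open Scope card_scope.
Local Open Scope ring_scope.

(* N = 'cV[int]_2, N_Q = 'cV[rat]_2 and, dually, M_Q = 'rV[rat]_2, so that
   u(x) is the entry of the 1 x 1 matrix u *m x. *)

Definition conv_hull (K : numDomainType) (V : lmodType K) (A : set V) :
    set V :=
  smallest (@convex_set K V) A.

(* The vertices of a convex polygon are its extreme points. *)
Definition vertices (K : numDomainType) (V : lmodType K) (A : set V) :
    set V :=
  [set v | A v /\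
     forall (x y : V) (t : K), A x -> A y -> 0 < t < 1 ->
       v = t *: x + (1 - t) *: y -> x = v /\ y = v].

(* A is typed over an abstract K because the topology on matrices is found
   from the numFieldType of the entries, not from the bare type rat. *)
Definition origin_interior (K : numFieldType) (A : set 'cV[K]_2) : Prop :=
  A° 0.

Definition lattice_pt (x y : int) : 'cV[int]_2 := \col_i [:: x; y]`_i.

Definition lattice_hull (s : seq 'cV[int]_2) : set 'cV[rat]_2 :=
  conv_hull [set map_mx intr v | v in [set` s]].

(* Degenerate hulls are not excluded here: in fano they are ruled out by the
   interior condition. *)
Definition lattice_polygon (P : set 'cV[rat]_2) : Prop :=
  exists s : seq 'cV[int]_2, P = lattice_hull s.

Definition primitive (v : 'cV[int]_2) : Prop := gcdz (v 0 0) (v 1 0) = 1.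

Definition fano (P : set 'cV[rat]_2) : Prop :=
  [/\ lattice_polygon P,
      origin_interior P &
      forall v, vertices P v ->
        exists2 w : 'cV[int]_2, v = map_mx intr w & primitive w].

Definition dual_polygon (P : set 'cV[rat]_2) : set 'rV[rat]_2 :=
  [set u | forall x, P x -> -1 <= (u *m x) 0 0].

(* The polygon in M_R spanned by a polygon in M_Q; a subset of M_Q is
   Lebesgue-negligible, so centroids are computed on the former. *)
Definition real_polygon (R : realType) (S : set 'rV[rat]_2) :
    set 'rV[R]_2 :=
  conv_hull [set map_mx ratr u | u in S].
Arguments real_polygon R S : clear implicits.

Section Barycentre.
Variable R : realType.

Definition row_of_pair (p : R * R) : 'rV[R]_2 := \row_i [:: p.1; p.2]`_i.

Let mu := (@lebesgue_measure R \x @lebesgue_measure R)%E.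

Definition area (S : set 'rV[R]_2) : R := fine (mu (row_of_pair @^-1` S)).

Definition barycentre (S : set 'rV[R]_2) : 'rV[R]_2 :=
  (area S)^-1 *:
    \row_i Rintegral mu (row_of_pair @^-1` S) (fun p => row_of_pair p 0 i).

End Barycentre.

Definition kahler_einstein (R : realType) (P : set 'cV[rat]_2) : Prop :=
  barycentre (real_polygon R (dual_polygon P)) = 0.

Definition aut (P : set 'cV[rat]_2) : set 'M[int]_2 :=
  [set G | G \in unitmx /\ [set map_mx intr G *m x | x in P] = P].

Definition symmetric_polygon (P : set 'cV[rat]_2) : Prop :=
  forall x : 'cV[rat]_2,
    (forall G, aut P G -> map_mx intr G *m x = x) -> x = 0.

Definition triangle (P : set 'cV[rat]_2) : Prop := vertices P #= `I_3.

Definition quadrilateral (P : set 'cV[rat]_2) : Prop := vertices P #= `I_4.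

(* Main.v *)
Require Import Defs.
From mathcomp Require Import all_boot all_order all_algebra.
From mathcomp Require Import all_classical all_reals all_analysis.
From mathcomp Require Import measurable_realfun finmap ring lra.

(** Write A = (-9,-190), B = (19,27), C = (15,113), D = (-13,112) for the four
    points, in counterclockwise order.

    Both P and its dual are quadrilaterals, and for each of them the
    description by vertices has to be matched with the description by four
    half-planes.  This is done once, in [convex_quadrilateral]: a point that
    lies on the inner side of the four edges lies in one of the two triangles
    cut out by a diagonal, hence is a convex combination of three vertices.
    Over the rationals it shows that P contains a box around the origin; over
    the reals it shows that the real dual polygon is the set of u with
    u(v) >= -1 for the four v above ([real_dual_quad]).  The extreme points of
    P are generators ([vertices_conv_hull]), and each generator is extreme
    because two edges of P meet there in that point only ([corner_vertex]).

    Since the barycentre is a multiple of the vector of first moments, it is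
    enough that both first moments of the dual vanish.  The vertices of the
    dual have abscissas -31/481 < -43/871 < 1/3149 < 151/1739; over this range
    the upper boundary is the single edge defined by A, and the lower one
    consists of the edges defined by B, C and D in turn.  Fubini's theorem
    ([integral_strip]) turns the integral of a linear form over each of the
    three resulting trapezoids into the integral of a quadratic polynomial
    ([integral_trapezoid]), and the three rational numbers add up to 0.

    Finally, an automorphism G of P permutes the vertices and preserves the
    absolute value of the determinant of a pair of them.  For the six pairs
    AB, BC, CD, DA, AC, BD these are 3367, 1742, 3149, 3478, 1833, 2479, all
    distinct, so G maps {A,B} to {A,B} and {B,C} to {B,C}.  Hence GB = B, and P
    is not symmetric.  Having four vertices, it is not a triangle either, so it
    refutes the general assertion. *)

Set Implicit Arguments.
Unset Strict Implicit.
Unset Printing Implicit Defensive.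

Import Order.TTheory GRing.Theory Num.Theory.
Import numFieldNormedType.Exports.

Local Open Scope classical_set_scope.
Local Open Scope card_scope.
Local Open Scope ring_scope.

(** * Convex hulls and extreme points *)

Section Convexity.
Variables (K : realFieldType) (V : lmodType K).
Implicit Types (A C : set V) (f g : V -> K).

Lemma convex_setP C : @convex_set K V C <->
  forall (x y : V) (t : K), C x -> C y -> 0 <= t <= 1 ->
    C (t *: x + (1 - t) *: y).
Proof.
split=> [cC x y t Cx Cy /andP[t0 t1] | cC x y t /set_mem Cx /set_mem Cy].
  exact: (set_mem (cC x y (Itv01 t0 t1) (mem_set Cx) (mem_set Cy))).
by apply/mem_set; apply: (cC x y t%:num) => //; rewrite ge0 le1.
Qed.

Lemma conv_hull_convex A : @convex_set K V (conv_hull A).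
Proof.
apply/convex_setP => x y t Cx Cy t01 C [cC AC].
by apply: (iffLR (convex_setP C)) => //; [exact: Cx | exact: Cy].
Qed.

Lemma sub_conv_hull A : A `<=` conv_hull A.
Proof. exact: sub_smallest. Qed.

Lemma scalar_conv f x y (t : K) : scalar f ->
  f (t *: x + (1 - t) *: y) = t * f x + (1 - t) * f y.
Proof.
move=> lf; have f0 : f 0 = 0.
  by have := lf (-1) 0 0; rewrite scaleN1r oppr0 add0r mulN1r addrC subrr.
by rewrite lf -[(1 - t) *: y]addr0 lf f0 addr0.
Qed.

Lemma conv_hull_halfspace f (c : K) A : scalar f ->
  (forall x, A x -> c <= f x) -> forall x, conv_hull A x -> c <= f x.
Proof.
move=> lf Ac; apply: smallest_sub => //.
apply/convex_setP => x y t /= cx cy /andP[t0 t1].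
by rewrite scalar_conv //; nra.
Qed.

(** Removing an extreme point from a convex set leaves a convex set; if the
    point were not a generator, the hull would be contained in that smaller
    set. *)
Lemma vertices_conv_hull A : vertices (conv_hull A) `<=` A.
Proof.
move=> v [Cv ext]; apply: contrapT => nAv.
suff /(_ _ Cv)[] : conv_hull A `<=` [set x | conv_hull A x /\ x <> v] by [].
apply: smallest_sub => [|x Ax]; last first.
  by split; [exact: sub_conv_hull | move=> xv; apply: nAv; rewrite -xv].
apply/convex_setP => x y t [Cx xv] [Cy yv] /andP[t0 t1]; split.
  by apply: (iffLR (convex_setP _) (@conv_hull_convex A)) => //; rewrite t0.
have [->|tn0] := eqVneq t 0; first by rewrite scale0r add0r subr0 scale1r.
have [->|tn1] := eqVneq t 1; first by rewrite subrr scale0r addr0 scale1r.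
move=> e; apply: xv; have [] // := ext x y t Cx Cy.
by rewrite lt_def tn0 t0 lt_def eq_sym tn1 t1.
Qed.

(** If an inequality valid on A is tight at a proper convex combination, it is
    tight at both ends; so the ends satisfy the two equations that determine
    v. *)
Lemma corner_vertex f g (a b : K) A v : scalar f -> scalar g -> A v ->
  (forall x, A x -> a <= f x /\ b <= g x) -> f v = a -> g v = b ->
  (forall x, f x = a -> g x = b -> x = v) -> vertices A v.
Proof.
move=> lf lg Av Aab fv gv uniq; split=> // x y t Ax Ay /andP[t0 t1] e.
have [fx gx] := Aab _ Ax; have [fy gy] := Aab _ Ay.
have tight (c p q : K) : c <= p -> c <= q -> t * p + (1 - t) * q = c ->
    p = c /\ q = c.
  move=> cp cq cE.
  by split; apply/eqP; rewrite eq_le ?cp ?cq andbT; nra.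
have [fxa fya] : f x = a /\ f y = a.
  by apply: tight; rewrite // -scalar_conv // -e.
have [gxb gyb] : g x = b /\ g y = b.
  by apply: tight; rewrite // -scalar_conv // -e.
by split; apply: uniq.
Qed.

End Convexity.

(** * Triangles and quadrilaterals in a coordinate plane *)

Section PlanarHulls.
(** The plane is spanned by two vectors of an arbitrary module, so that the
    results apply to columns and to rows alike. *)
Variables (K : realFieldType) (V : lmodType K) (e1 e2 : V).
Implicit Types (p q r : K * K).

Definition plane_pt p : V := p.1 *: e1 + p.2 *: e2.

(** Twice the signed area of the triangle pqr: it is positive when r lies to
    the left of the oriented line from p to q. *)
Definition orient p q r : K :=
  (q.1 - p.1) * (r.2 - p.2) - (q.2 - p.2) * (r.1 - p.1).

(** The barycentric coordinates of q are the areas that q spans with the sides,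
    divided by the area of the triangle. *)
Lemma convex_triangle (A : set V) p0 p1 p2 q : @convex_set K V A ->
  A (plane_pt p0) -> A (plane_pt p1) -> A (plane_pt p2) ->
  0 < orient p0 p1 p2 -> 0 <= orient p0 p1 q -> 0 <= orient p1 p2 q ->
  0 <= orient p2 p0 q -> A (plane_pt q).
Proof.
move=> /convex_setP cA A0 A1 A2 d0 h2 h0 h1.
pose d := orient p0 p1 p2.
pose a := orient p1 p2 q / d; pose b := orient p2 p0 q / d.
pose c := orient p0 p1 q / d.
have dn0 : d != 0 by rewrite gt_eqF.
have a0 : 0 <= a by rewrite divr_ge0 // ltW.
have b0 : 0 <= b by rewrite divr_ge0 // ltW.
have c0 : 0 <= c by rewrite divr_ge0 // ltW.
have abc : a + b + c = 1.
  rewrite /a /b /c -!mulrDl; apply/(canLR (mulfK dn0)).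
  by rewrite /d /orient; ring.
have bar (u v w z : K) : orient p1 p2 q * u + orient p2 p0 q * v
    + orient p0 p1 q * w = d * z -> z = a * u + b * v + c * w.
  by move=> e; apply: (mulfI dn0); rewrite -e /a /b /c; field.
have q1 : q.1 = a * p0.1 + b * p1.1 + c * p2.1.
  by apply: bar; rewrite /d /orient; ring.
have q2 : q.2 = a * p0.2 + b * p1.2 + c * p2.2.
  by apply: bar; rewrite /d /orient; ring.
(* [convex_set] speaks of two points only: first join p0 and p1 in the
   proportion a : b, then join the result with p2. *)
have [c1|cn1] := eqVneq c 1.
  have [az bz] : a = 0 /\ b = 0 by split; lra.
  by rewrite /plane_pt q1 q2 az bz c1 !mul0r !add0r !mul1r.
have c1 : 0 < 1 - c by rewrite subr_gt0 lt_neqAle cn1; lra.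
have cn0 : 1 - c != 0 by rewrite gt_eqF.
pose t := a / (1 - c).
have t1 : 1 - t = b / (1 - c).
  by have -> : b = (1 - c) - a by [lra]; rewrite /t; field.
have t01 : 0 <= t <= 1.
  by rewrite divr_ge0 ?(ltW c1) //= -subr_ge0 t1 divr_ge0 ?(ltW c1).
have c01 : 0 <= c <= 1 by rewrite c0 -subr_ge0 ltW.
have lin (s u : K) p r : s *: plane_pt p + u *: plane_pt r =
    plane_pt (s * p.1 + u * r.1, s * p.2 + u * r.2).
  by rewrite /plane_pt !scalerDr !scalerA !scalerDl addrACA.
have := cA _ _ _ A2 (cA _ _ _ A0 A1 t01) c01.
rewrite !lin /= t1 /t; congr (A (plane_pt _)).
by rewrite [q]surjective_pairing q1 q2; congr pair; field.
Qed.

Lemma convex_quadrilateral (A : set V) p0 p1 p2 p3 q : @convex_set K V A ->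
  A (plane_pt p0) -> A (plane_pt p1) -> A (plane_pt p2) -> A (plane_pt p3) ->
  0 < orient p0 p1 p2 -> 0 < orient p0 p2 p3 ->
  0 <= orient p0 p1 q -> 0 <= orient p1 p2 q ->
  0 <= orient p2 p3 q -> 0 <= orient p3 p0 q -> A (plane_pt q).
Proof.
move=> cA A0 A1 A2 A3 d1 d2 h01 h12 h23 h30.
have [h|h] := leP 0 (orient p2 p0 q).
  exact: (convex_triangle cA A0 A1 A2).
apply: (convex_triangle cA A0 A2 A3) => //.
by apply: ltW; move: h; rewrite -oppr_gt0; congr (_ < _);
  rewrite /orient; ring.
Qed.

End PlanarHulls.

Section ColumnsAndRows.
Variable K : realFieldType.

Lemma col2E (v : 'cV[K]_2) :
  v = plane_pt (delta_mx 0 0) (delta_mx 1 0) (v 0 0, v 1 0).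
Proof.
apply/matrixP => i j; rewrite (ord1 j) !mxE /=.
by case: i => -[|[|]] //= *;
  rewrite ?mulr1 ?mulr0 ?addr0 ?add0r; congr (v _ _); exact/val_inj.
Qed.

Lemma row2E (u : 'rV[K]_2) :
  u = plane_pt (delta_mx 0 0) (delta_mx 0 1) (u 0 0, u 0 1).
Proof.
apply/matrixP => i j; rewrite (ord1 i) !mxE /=.
by case: j => -[|[|]] //= *;
  rewrite ?mulr1 ?mulr0 ?addr0 ?add0r; congr (u _ _); exact/val_inj.
Qed.

Lemma pairingE (u : 'rV[K]_2) (v : 'cV[K]_2) :
  (u *m v) 0 0 = u 0 0 * v 0 0 + u 0 1 * v 1 0.
Proof.
rewrite mxE !big_ord_recl big_ord0 addr0.
by congr (_ + u _ _ * v _ _); exact/val_inj.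
Qed.

Lemma scalar_pairingl (v : 'cV[K]_2) :
  scalar (fun u : 'rV[K]_2 => (u *m v) 0 0).
Proof. by move=> a x y; rewrite mulmxDl -scalemxAl !mxE. Qed.

Lemma scalar_pairingr (u : 'rV[K]_2) :
  scalar (fun v : 'cV[K]_2 => (u *m v) 0 0).
Proof. by move=> a x y; rewrite mulmxDr -scalemxAr !mxE. Qed.

End ColumnsAndRows.

Lemma origin_interior_box (K : numFieldType) (A : set 'cV[K]_2) (e : K) :
  0 < e -> (forall v : 'cV[K]_2, `|v 0 0| < e -> `|v 1 0| < e -> A v) ->
  origin_interior A.
Proof.
move=> e0 boxA; apply/nbhs_ballP; exists e => //= v [_ v_e].
by apply: boxA; [have := v_e 0 0 | have := v_e 1 0];
  rewrite /ball /= mxE sub0r normrN.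
Qed.

(** * Lattice polygons, their duals and their automorphisms *)

Lemma sub_lattice_hull (s : seq 'cV[int]_2) v :
  v \in s -> lattice_hull s (map_mx intr v).
Proof. by move=> vs; apply: sub_conv_hull; exists v. Qed.

Lemma dual_lattice_hull (s : seq 'cV[int]_2) : dual_polygon (lattice_hull s) =
  [set u | forall v, v \in s -> -1 <= (u *m map_mx intr v) 0 0].
Proof.
apply/seteqP; split => u /= hu.
  by move=> v vs; apply: hu; exact: sub_lattice_hull.
move=> x; apply: (conv_hull_halfspace (scalar_pairingr u)).
by move=> _ [v vs <-]; exact: hu.
Qed.

Lemma lattice_pt_intr (K : pzRingType) (x y : int) :
  ((map_mx intr (lattice_pt x y) : 'cV[K]_2) 0 0 = x%:~R) *
  ((map_mx intr (lattice_pt x y) : 'cV[K]_2) 1 0 = y%:~R).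
Proof. by rewrite !mxE. Qed.

Lemma lattice_pt_plane (K : realFieldType) (x y : int) :
  (map_mx intr (lattice_pt x y) : 'cV[K]_2) =
  plane_pt (delta_mx 0 0) (delta_mx 1 0) (x%:~R, y%:~R).
Proof. by rewrite [LHS]col2E !mxE. Qed.

Definition rat_row (a b : rat) : 'rV[rat]_2 := \row_i [:: a; b]`_i.

Lemma rat_row_pairing a b (v : 'cV[rat]_2) :
  (rat_row a b *m v) 0 0 = a * v 0 0 + b * v 1 0.
Proof. by rewrite pairingE !mxE. Qed.

(** The next two equivalences are used as views.  Rewriting would compare the
    rational entries of different rows up to conversion, that is, by unfolding
    the arithmetic of the rationals. *)
Lemma rat_row_halfplane a b (v : 'cV[rat]_2) :
  -1 <= (rat_row a b *m v) 0 0 <-> -1 <= a * v 0 0 + b * v 1 0.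
Proof. by rewrite rat_row_pairing. Qed.

Lemma rat_row_lattice_pt a b x y :
  -1 <= (rat_row a b *m map_mx intr (lattice_pt x y)) 0 0 <->
  -1 <= a * x%:~R + b * y%:~R.
Proof. by rewrite rat_row_pairing !lattice_pt_intr. Qed.

Lemma pairing_ratr (R : realType) (u : 'rV[rat]_2) (v : 'cV[int]_2) :
  (map_mx ratr u *m map_mx intr v) 0 0 =
  ratr ((u *m map_mx intr v) 0 0) :> R.
Proof. by rewrite !pairingE rmorphD !rmorphM /= !mxE !ratr_int. Qed.

Lemma aut_vertices P G x :
  aut P G -> vertices P x -> vertices P (map_mx intr G *m x).
Proof.
move=> [uG GP] [Px ext].
have uGQ : (map_mx intr G : 'M[rat]_2) \in unitmx.
  by rewrite unitmxE det_map_mx rmorph_unit // -unitmxE.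
have inj (y z : 'cV[rat]_2) : map_mx intr G *m y = map_mx intr G *m z -> y = z.
  exact: (can_inj (mulKmx uGQ)).
split=> [|y z t]; first by rewrite -GP; exists x.
rewrite -{1 2}GP => - [y' Py' <-] [z' Pz' <-] t01.
by rewrite !scalemxAr -mulmxDr => /inj /(ext _ _ _ Py' Pz' t01)[-> ->].
Qed.

Lemma det_mx22 (K : comPzRingType) (M : 'M[K]_2) :
  \det M = M 0 0 * M 1 1 - M 0 1 * M 1 0.
Proof.
rewrite (expand_det_row _ 0) !big_ord_recl big_ord0 /cofactor !det_mx11 !mxE.
have -> : lift ord0 ord0 = 1 :> 'I_2 by exact/val_inj.
have -> : lift 1 0 = 0 :> 'I_2 by exact/val_inj.
by rewrite /= expr0 expr1 mul1r mulN1r mulrN addr0.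
Qed.

Definition det2 (u v : 'cV[int]_2) : int := \det (row_mx u v).

Lemma det2_lattice_pt x y x' y' :
  det2 (lattice_pt x y) (lattice_pt x' y') = x * y' - y * x'.
Proof.
have c0 (u v : 'cV[int]_2) i : row_mx u v i 0 = u i 0.
  by rewrite -(row_mxEl u v); congr (row_mx u v _ _); exact/val_inj.
have c1 (u v : 'cV[int]_2) i : row_mx u v i 1 = v i 0.
  by rewrite -(row_mxEr u v); congr (row_mx u v _ _); exact/val_inj.
by rewrite /det2 det_mx22 !c0 !c1 !mxE /= [x' * y]mulrC.
Qed.

Lemma det2_unit G u v :
  G \in unitmx -> `|det2 (G *m u) (G *m v)| = `|det2 u v|.
Proof.
rewrite unitmxE /det2 -mul_mx_row det_mulmx normrM.
by rewrite qualifE /= => /orP[] /eqP ->; rewrite ?normrN normr1 mul1r.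
Qed.

(** * The quadrilateral and its dual *)

Definition quad_pts : seq 'cV[int]_2 :=
  [:: lattice_pt (-9) (-190); lattice_pt 19 27; lattice_pt 15 113;
      lattice_pt (-13) 112].

Notation quad := (lattice_hull quad_pts).

(** The vertices of the dual polygon: the solutions u of u(v) = u(w) = -1 for
    the edges vw = AB, BC, CD, DA, in this order. *)
Definition dual_pts : seq 'rV[rat]_2 :=
  [:: rat_row (- 31 / 481) (4 / 481); rat_row (- 43 / 871) (- 2 / 871);
      rat_row (1 / 3149) (- 28 / 3149); rat_row (151 / 1739) (2 / 1739)].

Lemma mem_seq4P (T : eqType) (a b c d : T) (Q : T -> Prop) :
  (forall x, x \in [:: a; b; c; d] -> Q x) <-> [/\ Q a, Q b, Q c & Q d].
Proof.
split=> [h | [Qa Qb Qc Qd] x].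
  by split; apply: h; rewrite !inE eqxx ?orbT.
by rewrite !inE => /or4P[] /eqP ->.
Qed.

Lemma dual_pts_dual w : w \in dual_pts -> dual_polygon quad w.
Proof.
rewrite dual_lattice_hull /=; move: w; apply/mem_seq4P.
by split; apply/mem_seq4P; split; apply/rat_row_lattice_pt; lra.
Qed.

Lemma quad_halfplanes v : quad v <->
  (forall w, w \in dual_pts -> -1 <= (w *m v) 0 0).
Proof.
split=> [Pv w /dual_pts_dual | ]; first exact.
case/mem_seq4P => /rat_row_halfplane h0 /rat_row_halfplane h1.
move=> /rat_row_halfplane h2 /rat_row_halfplane h3.
have gen x y : lattice_pt x y \in quad_pts ->
    quad (plane_pt (delta_mx 0 0) (delta_mx 1 0) (x%:~R, y%:~R)).
  by move/sub_lattice_hull; rewrite lattice_pt_plane.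
have [/gen A0 /gen A1 /gen A2 /gen A3] :=
  iffLR (mem_seq4P _ _ _ _ (fun p => p \in quad_pts)) (fun p pq => pq).
rewrite (col2E v).
by apply: (convex_quadrilateral (@conv_hull_convex _ _ _) A0 A1 A2 A3);
  clear A0 A1 A2 A3 gen; cbv [orient fst snd]; lra.
Qed.

Lemma quad_origin_interior : origin_interior quad.
Proof.
(* The vertices (a, b) of the dual satisfy |a| + |b| < 1. *)
apply: (@origin_interior_box _ _ 1); first by [].
move=> v; rewrite !ltr_norml => /andP[a1 a2] /andP[b1 b2].
apply/quad_halfplanes/mem_seq4P.
by split; apply/rat_row_halfplane; lra.
Qed.

Lemma quad_corner a b a' b' x y :
  rat_row a b \in dual_pts -> rat_row a' b' \in dual_pts ->
  lattice_pt x y \in quad_pts ->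
  a * x%:~R + b * y%:~R = -1 -> a' * x%:~R + b' * y%:~R = -1 ->
  0 < a * b' - b * a' -> vertices quad (map_mx intr (lattice_pt x y)).
Proof.
move=> hw hw' hv wv wv' /lt0r_neq0 d0.
apply: (corner_vertex (scalar_pairingr (rat_row a b))
                      (scalar_pairingr (rat_row a' b'))).
- exact: sub_lattice_hull.
- by move=> z /quad_halfplanes Pz; split; exact: Pz.
- by rewrite rat_row_pairing !lattice_pt_intr.
- by rewrite rat_row_pairing !lattice_pt_intr.
move=> z; rewrite !rat_row_pairing => zw zw'.
have cramer1 p q : (a * b' - b * a') * p =
    b' * (a * p + b * q) - b * (a' * p + b' * q) by ring.
have cramer2 p q : (a * b' - b * a') * q =
    a * (a' * p + b' * q) - a' * (a * p + b * q) by ring.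
have zx : z 0 0 = x%:~R.
  apply: (mulfI d0).
  by rewrite (cramer1 _ (z 1 0)) (cramer1 _ y%:~R) zw zw' wv wv'.
have zy : z 1 0 = y%:~R.
  apply: (mulfI d0).
  by rewrite (cramer2 (z 0 0)) (cramer2 x%:~R) zw zw' wv wv'.
by rewrite (col2E z) lattice_pt_plane zx zy.
Qed.

Lemma quad_vertices :
  vertices quad = [set map_mx intr v | v in [set` quad_pts]].
Proof.
apply/seteqP; split; first exact: vertices_conv_hull.
have [m0 m1 m2 m3] :=
  iffLR (mem_seq4P _ _ _ _ (fun w => w \in dual_pts)) (fun w h => h).
have [v0 v1 v2 v3] :=
  iffLR (mem_seq4P _ _ _ _ (fun p => p \in quad_pts)) (fun p h => h).
move=> _ [v vs <-]; move: v vs; apply/mem_seq4P.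
split; [apply: (quad_corner m3 m0 v0)|apply: (quad_corner m0 m1 v1)
       |apply: (quad_corner m1 m2 v2)|apply: (quad_corner m2 m3 v3)];
  clear; lra.
Qed.

Lemma quad_fano : fano quad.
Proof.
split; [by exists quad_pts | exact: quad_origin_interior |].
rewrite quad_vertices => _ [v vs <-]; exists v => //.
by move: v vs; apply/mem_seq4P; split; rewrite /primitive !mxE.
Qed.

Lemma quad_quadrilateral : quadrilateral quad.
Proof.
rewrite /quadrilateral quad_vertices.
have inj : injective (map_mx intr : 'cV[int]_2 -> 'cV[rat]_2).
  by move=> v w /matrixP e; apply/matrixP => i j; have := e i j;
    rewrite !mxE => /intr_inj.
apply: (card_eq_trans (B := [set` quad_pts])).
  by apply: inj_card_eq; exact: in2W.
have -> : [set` quad_pts] = [set` [fset v in quad_pts]%fset].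
  by apply/seteqP; split=> v; rewrite /= in_fset; exact: id.
apply/card_eq_fsetP; rewrite card_fseq undup_id //.
(* The four points already have distinct abscissas. *)
have ne (x y x' y' : int) : x != x' -> lattice_pt x y != lattice_pt x' y'.
  by apply: contraNneq => /colP/(_ 0); rewrite !mxE /= => ->.
by rewrite /= !inE !negb_or !ne.
Qed.

Lemma aut_quad_pts G v : aut quad G -> v \in quad_pts -> G *m v \in quad_pts.
Proof.
move=> aG vP.
have : vertices quad (map_mx intr v) by rewrite quad_vertices; exists v.
move/(aut_vertices aG); rewrite -map_mxM quad_vertices => -[w wP /matrixP e].
suff -> : G *m v = w by [].
by apply/matrixP => i j; have := e i j; rewrite !mxE => /intr_inj.
Qed.

(** The vertex (19,27) is fixed: it is the common element of the two pairs of
    vertices with determinants 3367 and 1742 up to sign, and no other pair of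
    vertices has one of these determinants. *)
Lemma quad_not_symmetric : ~ symmetric_polygon quad.
Proof.
move/(_ (map_mx intr (lattice_pt 19 27))) => fixB.
have /colP/(_ 0) : map_mx intr (lattice_pt 19 27) = 0 :> 'cV[rat]_2.
  apply: fixB => G aG; rewrite -map_mxM; congr map_mx.
  have [uG _] := aG.
  have [A B C _] :=
    iffLR (mem_seq4P _ _ _ _ (fun p => G *m p \in quad_pts))
          (fun p => @aut_quad_pts G p aG).
  have := det2_unit (lattice_pt (-9) (-190)) (lattice_pt 19 27) uG.
  have := det2_unit (lattice_pt 15 113) (lattice_pt 19 27) uG.
  (* Of the 64 possible images of the three vertices, the two determinants
     exclude all that move the second vertex. *)
  move: A B C; rewrite !inE.
  by move=> /or4P[] /eqP -> /or4P[] /eqP -> /or4P[] /eqP ->;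
    rewrite !det2_lattice_pt.
by rewrite !mxE.
Qed.

Lemma real_dual_quad (R : realType) (u : 'rV[R]_2) :
  real_polygon R (dual_polygon quad) u <->
  forall v, v \in quad_pts -> -1 <= (u *m map_mx intr v) 0 0.
Proof.
split=> [hu v vs | /mem_seq4P[]].
  move: hu; apply: (conv_hull_halfspace (scalar_pairingl _)).
  move=> _ [w dw <-]; rewrite pairing_ratr -[-1](rmorphN1 (@ratr R)) ler_rat.
  by move: dw; rewrite dual_lattice_hull; apply.
rewrite !pairingE !lattice_pt_intr => h0 h1 h2 h3.
have gen a b a' b' : rat_row a b \in dual_pts -> ratr a = a' -> ratr b = b' ->
    real_polygon R (dual_polygon quad)
      (plane_pt (delta_mx 0 0) (delta_mx 0 1) (a', b')).
  move=> /dual_pts_dual dw aE bE; apply: sub_conv_hull.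
  by exists (rat_row a b); rewrite // [LHS]row2E !mxE aE bE.
have [m0 m1 m2 m3] :=
  iffLR (mem_seq4P _ _ _ _ (fun w => w \in dual_pts)) (fun w h => h).
have ratrE (p q : nat) : ratr (p%:R / q%:R) = p%:R / q%:R :> R.
  by rewrite fmorph_div /= !rmorph_nat.
have ratrNE (p q : nat) : ratr (- p%:R / q%:R) = - p%:R / q%:R :> R.
  by rewrite fmorph_div /= rmorphN !rmorph_nat.
have ratr1E (q : nat) : ratr (1 / q%:R) = 1 / q%:R :> R.
  by rewrite fmorph_div /= rmorph1 rmorph_nat.
have A0 := gen _ _ _ _ m0 (ratrNE _ _) (ratrE _ _).
have A1 := gen _ _ _ _ m1 (ratrNE _ _) (ratrNE _ _).
have A2 := gen _ _ _ _ m2 (ratr1E _) (ratrNE _ _).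
have A3 := gen _ _ _ _ m3 (ratrE _ _) (ratrE _ _).
rewrite (row2E u).
by apply: (convex_quadrilateral (@conv_hull_convex _ _ _) A0 A1 A2 A3);
  clear A0 A1 A2 A3 m0 m1 m2 m3 gen ratrE ratrNE ratr1E;
  cbv [orient fst snd]; lra.
Qed.

(** * Integrals over plane regions between two graphs *)

Section PlanarIntegrals.
Variable R : realType.
Notation lambda := (@lebesgue_measure R).
Notation mu := (lambda \x lambda)%E.

Lemma integral_deriv_poly (p : {poly R}) (a b : R) (c d : bool) : a <= b ->
  (\int[lambda]_(x in [set` Interval (BSide c a) (BSide d b)])
     (p^`().[x])%:E = (p.[b] - p.[a])%:E)%E.
Proof.
have mp : measurable_fun `]a, b[ (EFin \o horner p^`()).
  apply/measurable_EFinP; apply: measurable_funTS.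
  by apply: continuous_measurable_fun => x; exact: continuous_horner.
move=> ab; rewrite integral_itv_bndoo // -(integral_itv_bndoo true false) //.
move: ab; rewrite le_eqVlt => /predU1P[->|ab].
  by rewrite set_itv1 integral_set1 subrr.
apply: (@continuous_FTC2 R (horner p^`()) (horner p)) => //.
- exact/continuous_subspaceT/continuous_horner.
- split=> [x _| |]; first exact: derivable_horner.
  + exact/cvg_at_right_filter/continuous_horner.
  + exact/cvg_at_left_filter/continuous_horner.
- by move=> x _; rewrite derivE.
Qed.

Lemma integral_quadratic (k0 k1 k2 a b : R) (c d : bool) : a <= b ->
  (\int[lambda]_(x in [set` Interval (BSide c a) (BSide d b)])
     (k0 + k1 * x + k2 * x ^+ 2)%:E =
   (k0 * (b - a) + k1 * (b ^+ 2 - a ^+ 2) / 2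
     + k2 * (b ^+ 3 - a ^+ 3) / 3)%:E)%E.
Proof.
move=> ab.
pose p : {poly R} := k0 *: 'X + (k1 / 2) *: 'X^2 + (k2 / 3) *: 'X^3.
have -> : k0 * (b - a) + k1 * (b ^+ 2 - a ^+ 2) / 2
    + k2 * (b ^+ 3 - a ^+ 3) / 3 = p.[b] - p.[a].
  by rewrite /p !hornerE /=; field.
rewrite -(integral_deriv_poly p c d ab); apply: eq_integral => x _.
rewrite /p !derivD !derivZ derivX !derivXn !hornerE /=.
by congr EFin; field.
Qed.

(** The interval may be half-open, so that adjacent strips are disjoint. *)
Definition strip (I : interval R) (l u : R -> R) : set (R * R) :=
  [set z | z.1 \in I /\ l z.1 <= z.2 <= u z.1].

Lemma measurable_strip I l u : measurable_fun setT l -> measurable_fun setT u ->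
  measurable (strip I l u).
Proof.
move=> ml mu'.
have -> : strip I l u = (fst @^-1` [set` I]) `&`
    [set z : R * R | (l z.1 <= z.2) && (z.2 <= u z.1)].
  by apply/seteqP; split.
apply: measurableI.
  by rewrite -[X in measurable X]setTI; apply: measurable_fst.
have mb : measurable_fun setT
    (fun z : R * R => (l z.1 <= z.2) && (z.2 <= u z.1)).
  by apply: measurable_and; apply: measurable_fun_ler;
    try exact: measurable_snd; try exact: measurable_fst;
    apply: measurableT_comp => //; exact: measurable_fst.
by have := mb measurableT [set true]; rewrite setTI preimage_true; exact.
Qed.

Lemma affine_integrable (S : set (R * R)) (m k0 k1 k2 : R) : measurable S ->
  (forall z, S z -> -m <= z.1 <= m /\ -m <= z.2 <= m) ->
  mu.-integrable S (fun z => (k0 + k1 * z.1 + k2 * z.2)%:E).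
Proof.
move=> mS Sm; apply: measurable_bounded_integrable => //.
- apply: (@le_lt_trans _ _ (mu (`[-m, m] `*` `[-m, m]))).
    apply: le_measure; [exact: mem_set | | ].
      by apply: mem_set; exact: measurableX.
    by move=> z /Sm[z1 z2]; split; rewrite /= in_itv.
  have fin : (lambda [set` `[(- m)%R, m%R]] < +oo)%E.
    by rewrite lebesgue_measure_itv /=; case: ifP => _; rewrite -?EFinB ?ltry.
  rewrite product_measure1E //.
  apply: lte_mul_pinfty => //.
  by rewrite ge0_fin_numE.
- apply: measurable_funD; first apply: measurable_funD => //.
    by apply: measurable_funM => //; apply: measurable_funTS;
      exact: measurable_fst.
  by apply: measurable_funM => //; apply: measurable_funTS;
    exact: measurable_snd.
- exists (`|k0| + `|k1| * m + `|k2| * m); split; first exact: num_real.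
  move=> M /ltW hM z /Sm[]; rewrite -!ler_norml => z1 z2.
  apply: le_trans hM; apply: le_trans (ler_normD _ _) _.
  apply: lerD; last by rewrite normrM ler_wpM2l.
  apply: le_trans (ler_normD _ _) _.
  by rewrite lerD2l normrM ler_wpM2l.
Qed.

(** Fubini's theorem: the section of the strip above x is the segment
    [l x, u x] if x lies in I, and is empty otherwise. *)
Lemma integral_strip I l u (f : R * R -> R) : measurable (strip I l u) ->
  mu.-integrable (strip I l u) (EFin \o f) ->
  (\int[mu]_(z in strip I l u) (f z)%:E =
   \int[lambda]_(x in [set` I])
     \int[lambda]_(y in `[l x, u x]) (f (x, y))%:E)%E.
Proof.
move=> mS iS; have fS := iffLR (integrable_mkcond (mu := mu) _ mS) iS.
rewrite integral_mkcond -(integral12_prod_meas1 fS) [RHS]integral_mkcond.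
apply: eq_integral => x _; rewrite /fubini_F patchE.
case: ifPn => [/set_mem /= xI|/negP xI].
  rewrite [RHS]integral_mkcond; apply: eq_integral => y _.
  rewrite !patchE; congr (if _ then _ else _).
  apply/idP/idP => /set_mem h; apply/mem_set.
    by case: h => /= _; rewrite in_itv.
  by split=> //; move: h; rewrite /= in_itv.
apply: integral0_eq => y _; rewrite patchE ifN //.
by apply/negP => /set_mem[/= xI' _]; apply: xI; exact/mem_set.
Qed.

(** The moment of order one in the first coordinate of the trapezoid above
    [a, b] between the lines l0 + l1 x and u0 + u1 x: the integral over [a, b]
    of x (u(x) - l(x)). *)
Definition xmoment (a b l0 l1 u0 u1 : R) : R :=
  (u0 - l0) * (b ^+ 2 - a ^+ 2) / 2 + (u1 - l1) * (b ^+ 3 - a ^+ 3) / 3.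

(** The same in the second coordinate: the integral of
    (u(x)^2 - l(x)^2) / 2. *)
Definition ymoment (a b l0 l1 u0 u1 : R) : R :=
  ((u0 ^+ 2 - l0 ^+ 2) * (b - a) + (u0 * u1 - l0 * l1) * (b ^+ 2 - a ^+ 2)
   + (u1 ^+ 2 - l1 ^+ 2) * (b ^+ 3 - a ^+ 3) / 3) / 2.

Lemma integral_trapezoid (a b l0 l1 u0 u1 k1 k2 : R) (c d : bool)
  (T := strip (Interval (BSide c a) (BSide d b))
          (fun x => l0 + l1 * x) (fun x => u0 + u1 * x)) :
  a <= b -> l0 + l1 * a <= u0 + u1 * a -> l0 + l1 * b <= u0 + u1 * b ->
  measurable T -> mu.-integrable T (fun z => (k1 * z.1 + k2 * z.2)%:E) ->
  \int[mu]_(z in T) (k1 * z.1 + k2 * z.2) =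
  k1 * xmoment a b l0 l1 u0 u1 + k2 * ymoment a b l0 l1 u0 u1.
Proof.
move=> ab la lb mT iT; rewrite /Rintegral integral_strip //.
(* Coefficients of u - l = d0 + d1 x and of
   (u^2 - l^2) / 2 = s0 + s1 x + s2 x^2. *)
pose d0 := u0 - l0; pose d1 := u1 - l1.
pose s0 := (u0 ^+ 2 - l0 ^+ 2) / 2; pose s1 := u0 * u1 - l0 * l1.
pose s2 := (u1 ^+ 2 - l1 ^+ 2) / 2.
transitivity (fine (\int[lambda]_(x in [set` Interval (BSide c a) (BSide d b)])
  (k2 * s0 + (k1 * d0 + k2 * s1) * x + (k1 * d1 + k2 * s2) * x ^+ 2)%:E)%E).
  congr fine; apply: eq_integral => x /set_mem /= xI.
  have xab : a <= x <= b.
    move: xI; rewrite itv_boundlr => /andP[ax xb].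
    by move: ax xb; case: (c); case: (d); rewrite !bnd_simp => ax xb;
      rewrite ?ax ?xb ?(ltW ax) ?(ltW xb).
  have lu : l0 + l1 * x <= u0 + u1 * x.
    by move: xab => /andP[ax xb]; have [h|h] := leP 0 (u1 - l1); nra.
  transitivity (\int[lambda]_(y in `[(l0 + l1 * x)%R, (u0 + u1 * x)%R])
      (k1 * x + k2 * y + 0 * y ^+ 2)%:E)%E.
    by apply: eq_integral => y _; rewrite mul0r addr0.
  rewrite (@integral_quadratic _ _ _ _ _ true false lu); congr EFin.
  by rewrite /d0 /d1 /s0 /s1 /s2; field.
rewrite integral_quadratic //= /xmoment /ymoment /d0 /d1 /s0 /s1 /s2.
by field.
Qed.

End PlanarIntegrals.

(** * The barycentre of the dual polygon *)

Section KahlerEinstein.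
Variable R : realType.
Notation mu := (@lebesgue_measure R \x @lebesgue_measure R)%E.

Let upper (x : R) : R := 1 / 190 + (- 9 / 190) * x.

(** The vertical lines through the vertices cut the dual polygon into three
    trapezoids. *)
Definition slab1 := strip
  (Interval (BLeft (- 31 / 481)) (BLeft (- 43 / 871)))
  (fun x => - 1 / 27 + (- 19 / 27) * x) upper.
Definition slab2 := strip
  (Interval (BLeft (- 43 / 871)) (BLeft (1 / 3149)))
  (fun x => - 1 / 113 + (- 15 / 113) * x) upper.
Definition slab3 := strip
  (Interval (BLeft (1 / 3149)) (BRight (151 / 1739)))
  (fun x => - 1 / 112 + 13 / 112 * x) upper.

Lemma row_of_pairE (p : R * R) :
  (row_of_pair p 0 0 = p.1) * (row_of_pair p 0 1 = p.2).
Proof. by rewrite !mxE. Qed.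

Lemma real_dual_slabs :
  @row_of_pair R @^-1` real_polygon R (dual_polygon quad) =
  slab1 `|` (slab2 `|` slab3).
Proof.
apply/seteqP; split=> [p /= /real_dual_quad/mem_seq4P[] | p hp].
  rewrite !pairingE !lattice_pt_intr !row_of_pairE => h0 h1 h2 h3.
  rewrite /slab1 /slab2 /slab3 /strip /upper /= !in_itv /=.
  have [x1|x1] := ltP p.1 (- 43 / 871).
    by left; split; apply/andP; split; lra.
  have [x2|x2] := ltP p.1 (1 / 3149).
    by right; left; split; apply/andP; split; lra.
  by right; right; split; apply/andP; split; lra.
apply/real_dual_quad/mem_seq4P.
rewrite !pairingE !lattice_pt_intr !row_of_pairE.
by move: hp => [|[]] []; rewrite in_itv /= /upper => /andP[x1 x2] /andP[y1 y2];
  split; lra.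
Qed.

Lemma measurable_affine (k0 k1 : R) :
  measurable_fun setT (fun x : R => k0 + k1 * x).
Proof. exact: measurable_funD. Qed.

Lemma slab_moments (k1 k2 : R) :
  \int[mu]_(z in slab1 `|` (slab2 `|` slab3)) (k1 * z.1 + k2 * z.2) = 0.
Proof.
have m1 : measurable slab1 by apply: measurable_strip; exact: measurable_affine.
have m2 : measurable slab2 by apply: measurable_strip; exact: measurable_affine.
have m3 : measurable slab3 by apply: measurable_strip; exact: measurable_affine.
have m23 : measurable (slab2 `|` slab3) by exact: measurableU.
have m123 : measurable (slab1 `|` (slab2 `|` slab3)) by exact: measurableU.
have i123 : mu.-integrable (slab1 `|` (slab2 `|` slab3))
    (fun z => (k1 * z.1 + k2 * z.2)%:E).
  have : mu.-integrable (slab1 `|` (slab2 `|` slab3))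
      (fun z => (0 + k1 * z.1 + k2 * z.2)%:E).
    apply: (@affine_integrable _ _ 1) => // z; clear m1 m2 m3 m23 m123.
    by move=> [|[]] []; rewrite in_itv /= /upper => /andP[x1 x2] /andP[y1 y2];
      split; apply/andP; split; lra.
  by apply: eq_integrable => // z _; rewrite add0r.
have i23 : mu.-integrable (slab2 `|` slab3)
    (fun z => (k1 * z.1 + k2 * z.2)%:E).
  by apply: integrableS i123 => // z; right.
have i1 : mu.-integrable slab1 (fun z => (k1 * z.1 + k2 * z.2)%:E).
  by apply: integrableS i123 => // z; left.
have i2 : mu.-integrable slab2 (fun z => (k1 * z.1 + k2 * z.2)%:E).
  by apply: integrableS i23 => // z; left.
have i3 : mu.-integrable slab3 (fun z => (k1 * z.1 + k2 * z.2)%:E).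
  by apply: integrableS i23 => // z; right.
have disj1 : [disjoint slab1 & slab2 `|` slab3].
  apply/disj_setPS => z [[z1 _] z23]; move: z1 z23.
  by rewrite in_itv /= => /andP[_ x1] [] [];
    rewrite in_itv /= => /andP[x2 _] _; clear -x1 x2; lra.
have disj2 : [disjoint slab2 & slab3].
  apply/disj_setPS => z [[z2 _] [z3 _]]; move: z2 z3.
  by rewrite !in_itv /= => /andP[_ x1] /andP[x2 _]; clear -x1 x2; lra.
rewrite Rintegral_setU // Rintegral_setU //.
(* The side conditions left over say that the lower line of each slab does not
   exceed the upper one at either end. *)
rewrite !integral_trapezoid //; try (clear; lra).
by rewrite /xmoment /ymoment; clear; lra.
Qed.

Lemma quad_kahler_einstein : kahler_einstein R quad.
Proof.
rewrite /kahler_einstein /barycentre real_dual_slabs.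
suff -> : \row_i \int[mu]_(p in slab1 `|` (slab2 `|` slab3))
    row_of_pair p 0 i = 0 by rewrite scaler0.
apply/rowP => i; rewrite !mxE.
case: i => -[|[|//]] ?.
  rewrite -(slab_moments 1 0).
  by apply: eq_Rintegral => z _; rewrite !mxE /=; ring.
rewrite -(slab_moments 0 1).
by apply: eq_Rintegral => z _; rewrite !mxE /=; ring.
Qed.

End KahlerEinstein.

Theorem proposition1p5 (R : realType) :
  let P := lattice_hull [:: lattice_pt (-9) (-190); lattice_pt 19 27;
                            lattice_pt 15 113; lattice_pt (-13) 112] in
  [/\ fano P, kahler_einstein R P & quadrilateral P] /\
  ~ (forall Q : set 'cV[rat]_2, fano Q -> kahler_einstein R Q ->
       symmetric_polygon Q \/ triangle Q).
Proof.
move=> P; split.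
  split; [exact: quad_fano | exact: quad_kahler_einstein |].
  exact: quad_quadrilateral.
move=> /(_ quad quad_fano (quad_kahler_einstein R))[|tri].
  exact: quad_not_symmetric.
have := card_eq_trans (card_esym tri) quad_quadrilateral.
by move/card_eq_II.
Qed.
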